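(* Let $\Theta\subseteq\mathbb R^d$ be open, and for $\boldsymbol\theta\in\Theta$ let $P_{\boldsymbol\theta}^{(n)}$ be the distribution of the sample $\mathbf X=(X_1,\ldots,X_n)\in\mathcal X^n$, with likelihood $p_n(\mathbf x\mid\boldsymbol\theta)$ and expected $n$-sample Fisher information matrix $J_n(\boldsymbol\theta)$. Let $K\subset\Theta$ be compact, and let $\pi$ be a probability density on $K$ that is continuous and strictly positive on $K$. Put $r_n(\mathbf x)=\int_K p_n(\mathbf x\mid\boldsymbol\theta)\pi(\boldsymbol\theta)\,d\boldsymbol\theta$ and $\Pi(W)=\int_W\pi(\boldsymbol\vartheta)\,d\boldsymbol\vartheta$. Consider a sequence of codebooks $\mathcal C_n=(\mathcal P_n,q_n,\boldsymbol\theta_n)$, where $\mathcal P_n=\{P_{n,1},\ldots,P_{n,k_n}\}$ is a finite measurable partition of $\mathcal X^n$, $q_{n,j}=r_n(P_{n,j})>0$ for all $n,j$, and $\boldsymbol\theta_{n,j}\in K$ is the (quantised) assertion used for all data in $P_{n,j}$. For $\mathbf x\in P_{n,j}$ let $T_n(\mathbf x)\in K$ denote the corresponding unquantised local parameter estimate. Assume: (A1) $J_n(\boldsymbol\theta)$ is continuous and positive definite on $K$, and $\inf_{\boldsymbol\theta\in K}\lambda_{\min}\{J_n(\boldsymbol\theta)\}\to\infty$. (A2) For every bounded set $B\subset\mathbb R^d$, $$\sup_{\boldsymbol\theta\in K,\ \mathbf u\in B}\left|D_{\mathrm{KL}}\!\left(P^{(n)}_{\boldsymbol\theta+J_n(\boldsymbol\theta)^{-1/2}\mathbf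 u}\,\Vert\,P^{(n)}_{\boldsymbol\theta}\right)-\tfrac12\|\mathbf u\|^2\right|\to0 .$$ (A3) Each data-space cell $P_{n,j}$ induces a region $W_{n,j}\subset K$, interpreted as the set of unquantised local parameter values $T_n(\mathbf x)$ assigned to $\boldsymbol\theta_{n,j}$, such that $q_{n,j}=\Pi(W_{n,j})\exp(\alpha_{n,j})$ with $\sum_j q_{n,j}|\alpha_{n,j}|\to0$. Moreover $W_{n,j}=\{\boldsymbol\theta_{n,j}+J_n(\boldsymbol\theta_{n,j})^{-1/2}\mathbf u:\mathbf u\in C_{n,j}\}$, where $C_{n,j}\subset\mathbb R^d$ is measurable, contains the origin, has positive volume $V_{n,j}=\operatorname{Vol}(C_{n,j})$, and the sets $C_{n,j}$ have uniformly bounded diameter. (A4) With $\Delta_{n,j}=\mathbb E_{r_n}\left[-\log p_n(\mathbf X\mid\boldsymbol\theta_{n,j})+\log p_n\{\mathbf X\mid T_n(\mathbf X)\}\,\middle|\,\mathbf X\in P_{n,j}\right]$, one has $$\Delta_{n,j}=\frac1{\Pi(W_{n,j})}\int_{W_{n,j}}D_{\mathrm{KL}}\!\left(P^{(n)}_{\boldsymbol\vartheta}\,\Vert\,P^{(n)}_{\boldsymbol\theta_{n,j}}\right)\pi(\boldsymbol\vartheta)\,d\boldsymbol\vartheta+\varepsilon_{n,j},\qquad \sum_j q_{n,j}|\varepsilon_{n,j}|\to0 .$$ (A5) With $\Phi(C)=-\log V(C)+\frac1{2V(C)}\int_C\|\mathbf u\|^2\,d\mathbf u$ and $\kappa_d$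 the optimal $d$-dimensional normalised second-moment constant, $\sum_j q_{n,j}\Phi(C_{n,j})=\frac d2\log\kappa_d+\frac d2+o(1)$. (A6) With $\varphi_n(\boldsymbol\theta)=-\log\pi(\boldsymbol\theta)+\frac12\log|J_n(\boldsymbol\theta)|$, $\sum_j q_{n,j}\varphi_n(\boldsymbol\theta_{n,j})=\int_K\varphi_n(\boldsymbol\theta)\pi(\boldsymbol\theta)\,d\boldsymbol\theta+o(1)$. Suppose further that the expected high-rate expansion admits the following local, pointwise realisation by a local codelength $\Lambda_n^{\mathrm{ASMML}}(\mathbf x,\boldsymbol\theta;V)$, for $\boldsymbol\theta\in K$ and Fisher-normalised cell volumes $V>0$: $$\Lambda_n^{\mathrm{ASMML}}(\mathbf x,\boldsymbol\theta;V)=-\log p_n(\mathbf x\mid\boldsymbol\theta)-\log\pi(\boldsymbol\theta)+\frac12\log|J_n(\boldsymbol\theta)|-\log V+\frac{d\kappa_d}2V^{2/d}+o_{P^{(n)}_{\boldsymbol\theta}}(1),$$ where the remainder is uniform in $\boldsymbol\theta\in K$ and locally uniform in $V$ (uniform over compact subsets of $(0,\infty)$). Then the leading volume-dependent term $g(V)=-\log V+\frac{d\kappa_d}2V^{2/d}$ is uniquely minimised over $V>0$ at $V_{\mathrm{opt}}=\kappa_d^{-d/2}$, and $g(V_{\mathrm{opt}})=\frac d2\log\kappa_d+\frac d2$. Hence the locally optimised codelength is $$\Lambda_n^{\mathrm{ASMML}}(\mathbf x,\boldsymbol\theta;V_{\mathrm{opt}})=-\log p_n(\mathbf x\mid\boldsymbol\theta)-\log\pi(\boldsymbol\theta)+\frac12\log|J_n(\boldsymbol\theta)|+\frac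 d2\log\kappa_d+\frac d2+o_{P^{(n)}_{\boldsymbol\theta}}(1).$$ Consequently, with the Wallace--Freeman codelength $$\mathcal I_{\mathrm{WF}}(\mathbf x,\boldsymbol\theta)=-\log p_n(\mathbf x\mid\boldsymbol\theta)-\log\pi(\boldsymbol\theta)+\frac12\log|J_n(\boldsymbol\theta)|+\frac d2\log\kappa_d+\frac d2,$$ the corresponding local Wallace--Freeman estimator $\hat{\boldsymbol\theta}_{\mathrm{WF}}(\mathbf x)=\arg\min_{\boldsymbol\theta\in K}\mathcal I_{\mathrm{WF}}(\mathbf x,\boldsymbol\theta)$ equals $$\hat{\boldsymbol\theta}_{\mathrm{WF}}(\mathbf x)=\arg\min_{\boldsymbol\theta\in K}\left\{-\log p_n(\mathbf x\mid\boldsymbol\theta)-\log\pi(\boldsymbol\theta)+\frac12\log|J_n(\boldsymbol\theta)|\right\}.$$ If this minimiser lies in the interior of $K$, and the local expansion holds on a compact neighbourhood of the minimiser, then $\hat{\boldsymbol\theta}_{\mathrm{WF}}$ coincides with the usual Wallace--Freeman estimator.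
   Context: $|M|$ is the determinant of a matrix $M$, $\lambda_{\min}$ the smallest eigenvalue, $J^{-1/2}$ the inverse of the symmetric positive definite square root, $D_{\mathrm{KL}}(P\Vert Q)$ the Kullback--Leibler divergence, and $\mathbb E_{r_n}$ expectation when $\mathbf X$ has density $r_n$; $r_n(P)=\sum_{\mathbf x\in P}r_n(\mathbf x)$, with sums interpreted as integrals in the continuous case. Quantisation constants: for a Fisher-normalised cell $C\subset\mathbb R^d$ (measurable, containing the origin, bounded, of positive volume) write $V(C)=\operatorname{Vol}(C)$ and $$\kappa(C)=\frac1{d\,V(C)^{1+2/d}}\int_C\|\mathbf u\|^2\,d\mathbf u .$$ The optimal $d$-dimensional normalised second-moment constant is $\kappa_d=\inf_C\kappa(C)$. Remainder convention: writing $R_n(\mathbf x,\boldsymbol\theta;V)$ for the remainder, ''$o_{P^{(n)}_{\boldsymbol\theta}}(1)$, uniform in $\boldsymbol\theta\in K$ and locally uniform in $V$'' means that for every $\epsilon>0$ and every compact $L\subset(0,\infty)$, $\sup_{\boldsymbol\theta\in K}P^{(n)}_{\boldsymbol\theta}\{\sup_{V\in L}|R_n(\mathbf X,\boldsymbol\theta;V)|>\epsilon\}\to0$. The usual Wallace--Freeman estimator is the minimiser over the whole parameter space $\Theta$ of $-\log p_n(\mathbf x\mid\boldsymbol\theta)-\log\pi(\boldsymbol\theta)+\frac12\log|J_n(\boldsymbol\theta)|$, where the prior density $\pi$, being a density on $K$, is taken to be $0$ outside $K$ (so $-\log\pi=+\infty$ there). *)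

(* Defs.v *)
From HB Require Import structures.
From mathcomp Require Import all_boot all_order all_algebra.
From mathcomp Require Import all_classical all_reals all_analysis.
Import Order.TTheory GRing.Theory Num.Theory.
Import numFieldNormedType.Exports.
Set Implicit Arguments.
Unset Strict Implicit.
Unset Printing Implicit Defensive.
Local Open Scope classical_set_scope.
Local Open Scope ring_scope.

(* As for [n.-tuple T] in the library, row vectors carry the sigma-algebra
   generated by the coordinates; for [T = R] this is the Borel sigma-algebra. *)
Definition measure_rV_display : measure_display -> measure_display.
Proof. exact. Qed.

Section measurable_rV.
Context {disp} {T : sigmaRingType disp}.
Variable n : nat.

Let coords : 'I_n -> 'rV[T]_n -> T := fun i v => v ord0 i.

Let rV_set0 : g_sigma_preimage coords set0.
Proof. exact: sigma_algebra0. Qed.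

Let rV_setC A : g_sigma_preimage coords A -> g_sigma_preimage coords (~` A).
Proof. exact: sigma_algebraC. Qed.

Let rV_bigcup (F : _^nat) : (forall i, g_sigma_preimage coords (F i)) ->
  g_sigma_preimage coords (\bigcup_i (F i)).
Proof. exact: sigma_algebra_bigcup. Qed.

HB.instance Definition _ := @isMeasurable.Build (measure_rV_display disp)
  'rV[T]_n (g_sigma_preimage coords) rV_set0 rV_setC rV_bigcup.

End measurable_rV.

Section measurable_rV_fun.
Context {d1 d2} {T1 : measurableType d1} {T2 : measurableType d2}.

Lemma measurable_coord n (i : 'I_n) :
  measurable_fun [set: 'rV[T2]_n] (fun v : 'rV[T2]_n => v ord0 i).
Proof.
move=> _ Y mY; rewrite setTI; apply: sub_sigma_algebra => /=.
rewrite -bigcup_seq/=; exists i => /=; first by rewrite mem_index_enum.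
by exists Y => //; rewrite setTI.
Qed.

Lemma measurable_fun_rV n (f : T1 -> 'rV[T2]_n) :
  (forall i, measurable_fun [set: T1] (fun x => f x ord0 i)) ->
  measurable_fun [set: T1] f.
Proof.
move=> mf.
apply: (@measurability _ _ _ _ _ _ (\big[setU/set0]_(i < n)
  preimage_set_system setT (fun v : 'rV[T2]_n => v ord0 i) measurable)) => //.
move=> _ [B + <-]; rewrite -bigcup_seq/= => -[i _ [A mA <-]].
rewrite !setTI -[X in measurable X]setTI.
exact: mf.
Qed.

End measurable_rV_fun.

Section power_measure.
Context {disp} {T : measurableType disp} {R : realType}.
Variable m : {sigma_finite_measure set T -> \bar R}.

Definition rV_cons n (z : T * 'rV[T]_n) : 'rV[T]_n.+1 :=
  \row_i if unlift ord0 i is Some j then z.2 ord0 j else z.1.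

Definition rV_behead n (v : 'rV[T]_n.+1) : T * 'rV[T]_n :=
  (v ord0 ord0, \row_j v ord0 (lift ord0 j)).

Lemma rV_consK n : cancel (@rV_cons n) (@rV_behead n).
Proof.
move=> [x v]; rewrite /rV_behead !mxE unlift_none/=; congr pair.
by apply/rowP => j; rewrite !mxE liftK.
Qed.

Lemma measurable_rV_cons n : measurable_fun setT (@rV_cons n).
Proof.
apply: measurable_fun_rV => i.
case: (unliftP ord0 i) => [j|] ->.
- rewrite (_ : (fun x => _) = (fun v : 'rV[T]_n => v ord0 j) \o snd).
    exact: (measurableT_comp (measurable_coord j)).
  by apply/funext => z/=; rewrite mxE liftK.
- rewrite (_ : (fun x => _) = fst); first exact: measurable_fst.
  by apply/funext => z/=; rewrite mxE unlift_none.
Qed.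

Lemma measurable_rV_behead n : measurable_fun setT (@rV_behead n).
Proof.
apply/measurable_fun_pair; first exact: measurable_coord.
apply: measurable_fun_rV => i.
rewrite (_ : (fun x => _) = (fun v : 'rV[T]_n.+1 => v ord0 (lift ord0 i))).
  exact: measurable_coord.
by apply/funext => v; rewrite mxE.
Qed.

Section step.
Variables (n : nat) (mn : {sigma_finite_measure set 'rV[T]_n -> \bar R}).

Definition power_step : set 'rV[T]_n.+1 -> \bar R :=
  pushforward (m \x mn)%E (@rV_cons n).

Let preimage_rV_cons A : measurable A -> measurable (@rV_cons n @^-1` A).
Proof.
by move=> mA; rewrite -[X in measurable X]setTI; exact: measurable_rV_cons.
Qed.

Let power_step0 : power_step set0 = 0%E.
Proof. by rewrite /power_step /pushforward preimage_set0 measure0. Qed.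

Let power_step_ge0 A : (0 <= power_step A)%E.
Proof. exact: (measure_ge0 (m \x mn)%E). Qed.

Let power_step_sigma_additive : semi_sigma_additive power_step.
Proof.
move=> F mF tF mUF; rewrite /power_step /pushforward preimage_bigcup.
apply: measure_semi_sigma_additive => [i||].
- exact: preimage_rV_cons.
- apply/trivIsetP => /= i j _ _ ij; rewrite -preimage_setI.
  by move/trivIsetP : tF => /(_ _ _ _ _ ij) ->//; rewrite preimage_set0.
- by rewrite -preimage_bigcup; exact: preimage_rV_cons.
Qed.

HB.instance Definition _ := isMeasure.Build _ _ _ power_step
  power_step0 power_step_ge0 power_step_sigma_additive.

Let power_step_sigma_finite : sigma_finite setT power_step.
Proof.
have /sigma_finiteP[F [FT ndF Foo]] := sigma_finiteT m.
have /sigma_finiteP[G [GT ndG Goo]] := sigma_finiteT mn.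
exists (fun k => @rV_behead n @^-1` (F k `*` G k)).
  apply/seteqP; split=> // v _.
  have : setT (rV_behead v).1 by []; rewrite FT => -[i _ Fi].
  have : setT (rV_behead v).2 by []; rewrite GT => -[j _ Gj].
  exists (maxn i j) => //; split.
  - by move: Fi; exact/subsetPset/ndF/leq_maxl.
  - by move: Gj; exact/subsetPset/ndG/leq_maxr.
move=> k; have [mF Fk] := Foo k; have [mG Gk] := Goo k; split.
  rewrite -[X in measurable X]setTI.
  by apply: measurable_rV_behead => //; exact: measurableX.
rewrite /power_step /pushforward -comp_preimage.
rewrite (_ : @rV_behead n \o @rV_cons n = id) ?preimage_id; last first.
  exact/funext/rV_consK.
by rewrite product_measure1E// lte_mul_pinfty// ge0_fin_numE.
Qed.

HB.instance Definition _ := Measure_isSigmaFinite.Build _ _ _ power_step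
  power_step_sigma_finite.

End step.

Fixpoint power_measure n : {sigma_finite_measure set 'rV[T]_n -> \bar R} :=
  if n is n'.+1 then power_step (power_measure n') else \d_(const_mx point).

Lemma power_measureE n (A : 'I_n -> set T) : (forall i, measurable (A i)) ->
  power_measure n [set v : 'rV[T]_n | forall i, A i (v ord0 i)] = (\prod_(i < n) m (A i))%E.
Proof.
elim: n A => [|n ih] A mA.
  by rewrite big_ord0 /= diracE mem_set// => -[].
rewrite big_ord_recl -ih//= /power_step /pushforward.
rewrite -product_measure1E//; last first.
  rewrite (_ : mkset _ = \bigcap_(i in [set: 'I_n])
      (fun v : 'rV[T]_n => v ord0 i) @^-1` A (lift ord0 i)).
    apply: fin_bigcap_measurable => // i _; rewrite -[X in measurable X]setTI.
    exact: measurable_coord.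
  by apply/seteqP; split=> v /= Av i => [_|]; exact: Av.
congr product_measure1; apply/seteqP; split=> [z /= Az|z /= [Az1 Az2] i].
- split=> [|j].
  + by have := Az ord0; rewrite mxE unlift_none.
  + by have := Az (lift ord0 j); rewrite mxE liftK.
- by case: (unliftP ord0 i) => [j|] ->; rewrite mxE ?liftK ?unlift_none.
Qed.
End power_measure.

(* [lebesgue_measure] is declared on the alias [measurableTypeR R]; this copy is
   a measure on [R] with its canonical measurable structure. *)
Section lebesgue_rV.
Variable R : realType.

Definition lebesgue1 : set R -> \bar R := lebesgue_measure.

HB.instance Definition _ := @isMeasure.Build _ R R lebesgue1
  (measure0 (@lebesgue_measure R)) (measure_ge0 (@lebesgue_measure R))
  (@measure_semi_sigma_additive _ _ _ (@lebesgue_measure R)).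

HB.instance Definition _ := @Measure_isSigmaFinite.Build _ R R lebesgue1
  (sigma_finiteT (@lebesgue_measure R)).

Definition lebesgue_rV (d : nat) :
  {sigma_finite_measure set 'rV[R]_d -> \bar R} := power_measure lebesgue1 d.

Lemma lebesgue_rVE d (A : 'I_d -> set R) : (forall i, measurable (A i)) ->
  lebesgue_rV d [set v : 'rV[R]_d | forall i, A i (v ord0 i)] =
  (\prod_(i < d) lebesgue_measure (A i))%E.
Proof. exact: power_measureE. Qed.

End lebesgue_rV.

Section linear_algebra.
Context {R : realType} {d : nat}.
Implicit Types (u v : 'rV[R]_d) (A S : 'M[R]_d).

(* The library norm on row vectors is the sup norm. *)
Definition sqnorm u : R := \sum_(i < d) u ord0 i ^+ 2.

Definition enorm u : R := Num.sqrt (sqnorm u).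

Definition posdefmx A : Prop :=
  A^T = A /\ forall u, u != 0 -> 0 < (u *m A *m u^T) ord0 ord0.

(* The symmetric positive definite square root, unique when [A] is symmetric
   positive definite. *)
Definition sqrtmx A : 'M[R]_d := xget 0 [set S | posdefmx S /\ S *m S = A].

Definition invsqrtmx A : 'M[R]_d := invmx (sqrtmx A).

Definition lambda_min A : R := inf [set a | eigenvalue A a].

End linear_algebra.

Section quantisation.
Context {R : realType} {d : nat}.
Implicit Types C : set 'rV[R]_d.

Definition Vol C : R := fine (lebesgue_rV R d C).

Definition fisher_cell C : Prop :=
  [/\ measurable C, C 0, bounded_set C & 0 < Vol C].

Definition second_moment C : R := \int[lebesgue_rV R d]_(u in C) sqnorm u.

Definition kappa C : R :=
  second_moment C / (d%:R * Vol C `^ (1 + 2 / d%:R)).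

Definition Phi C : R := - ln (Vol C) + second_moment C / (2 * Vol C).

End quantisation.

Definition kappa_opt (R : realType) (d : nat) : R :=
  inf [set kappa C | C in @fisher_cell R d].

Definition volume_term (R : realType) (d : nat) (V : R) : R :=
  - ln V + d%:R * kappa_opt R d / 2 * V `^ (2 / d%:R).

Section model.
Local Open Scope charge_scope.
Context {R : realType} {disp : measure_display} {T : measurableType disp}.

Definition KL (P Q : probability T R) : \bar R :=
  if `[< P `<< Q >] then
    (\int[P]_x lne (('d (charge_of_finite_measure P) '/d Q) x))%E
  else +oo%E.

Context {d : nat}.
Implicit Types (p : T -> 'rV[R]_d -> R) (t : 'rV[R]_d).

Definition score p t (i : 'I_d) (x : T) : R :=
  'D_(delta_mx ord0 i) (fun s => ln (p x s)) t.

(* [J] is the expected Fisher information at [t], in the form E[s s^T] with [s]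
   the score; the first two clauses say that this expectation makes sense. *)
Definition fisher_information (P : probability T R) p t (J : 'M[R]_d) : Prop :=
  [/\ {ae P, forall x i, derivable (fun s => ln (p x s)) t (delta_mx ord0 i)},
      forall i j, P.-integrable setT (fun x => (score p t i x * score p t j x)%:E)
    & J = \matrix_(i, j) \int[P]_x (score p t i x * score p t j x)].

Definition prior_mass (prior : 'rV[R]_d -> R) (W : set 'rV[R]_d) : R :=
  \int[lebesgue_rV R d]_(t in W) prior t.

Definition marginal p (prior : 'rV[R]_d -> R) (K : set 'rV[R]_d) (x : T) :
  \bar R := (\int[lebesgue_rV R d]_(t in K) (p x t * prior t)%:E)%E.

(* Extended-real valued: [- lne 0 = +oo], so the value is [+oo] off the support
   of the prior and where the likelihood vanishes. The determinant term stays
   real valued so that it never competes with these infinities. *)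
Definition WF_objective p (prior : 'rV[R]_d -> R) (J : 'rV[R]_d -> 'M[R]_d)
    (x : T) t : \bar R :=
  (- lne (p x t)%:E - lne (prior t)%:E + (ln (\det (J t)) / 2)%:E)%E.

Definition WF_codelength p prior J (x : T) t : \bar R :=
  (WF_objective p prior J x t
   + (d%:R / 2 * ln (kappa_opt R d) + d%:R / 2)%:E)%E.

End model.

(* As usual for extended-real valued objectives, the identically [+oo]
   objective has no minimiser. *)
Definition argmin {R : realType} {U : Type} (D : set U) (f : U -> \bar R) :
    set U :=
  [set t | [/\ D t, (f t < +oo)%E & forall s, D s -> (f t <= f s)%E]].

Section remainder.
Context {R : realType} {disp : measure_display} {d : nat}.
Context {T : nat -> measurableType disp}.
Variable P : forall n, 'rV[R]_d -> probability (T n) R.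

(* [(P n t)^*] is the outer measure of [P n t], used because the events are not
   assumed to be measurable; it agrees with [P n t] on measurable sets. *)
Definition small_oP (S : set 'rV[R]_d)
    (rem : forall n, T n -> 'rV[R]_d -> R) : Prop :=
  forall e : R, 0 < e ->
    ereal_sup [set ((P n t)^*)%mu [set x | e < `|rem n x t|] | t in S]
      @[n --> \oo] --> 0%E.

Definition small_oP_locally_uniform (S : set 'rV[R]_d)
    (rem : forall n, T n -> 'rV[R]_d -> R -> R) : Prop :=
  forall (e : R) (L : set R), 0 < e -> compact L -> L `<=` [set V | 0 < V] ->
    ereal_sup [set ((P n t)^*)%mu
        [set x | (e%:E < ereal_sup [set `|rem n x t V|%:E | V in L])%E] | t in S]
      @[n --> \oo] --> 0%E.

Definition local_expansion (S : set 'rV[R]_d)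
    (lambda : forall n, T n -> 'rV[R]_d -> R -> \bar R)
    (objective : forall n, T n -> 'rV[R]_d -> \bar R) : Prop :=
  exists rem : forall n, T n -> 'rV[R]_d -> R -> R,
    (forall n x t V, (0 < n)%N -> S t -> 0 < V ->
       lambda n x t V
       = (objective n x t + (volume_term d V)%:E + (rem n x t V)%:E)%E) /\
    small_oP_locally_uniform S rem.

End remainder.

(* Main.v *)
(* The only analytic input is [kappa_opt > 0]: the part of a cell lying outside a
   centred cube of half its volume carries half the volume and stays at a distance
   from the origin comparable to [V ^ (1 / d)], so [kappa] is bounded below by a
   constant depending only on [d]. The volume term is then minimised by convexity
   of the exponential, the expansion is evaluated at [V = Vopt] (the compact
   [L = {Vopt}]), and the objective is [+oo] outside [K], so that enlarging [K] to
   [Theta] does not change its minimisers. *)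
Require Import Defs.
From HB Require Import structures.
From mathcomp Require Import all_boot all_order all_algebra.
From mathcomp Require Import all_classical all_reals all_analysis.
From mathcomp Require Import measurable_realfun ring lra.
Import Order.TTheory GRing.Theory Num.Theory.
Import numFieldNormedType.Exports.
Local Open Scope classical_set_scope.
Local Open Scope ring_scope.

(** * Centred cubes and the second moments of cells *)

Section cube.
Context {R : realType} {d : nat}.
Implicit Types (r : R) (C : set 'rV[R]_d).

(** The closed sup-norm ball, written coordinatewise so that [lebesgue_rVE] gives its volume. *)
Definition cube r : set 'rV[R]_d := [set v | forall i, `[- r, r]%classic (v ord0 i)].

Lemma measurable_cube r : measurable (cube r).
Proof.
rewrite (_ : cube r = \bigcap_(i in [set: 'I_d])
    (fun v : 'rV[R]_d => v ord0 i) @^-1` `[- r, r]%classic).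
  apply: fin_bigcap_measurable => // i _; rewrite -[X in measurable X]setTI.
  exact: measurable_coord.
by apply/seteqP; split=> v /= h i => [_|]; exact: h.
Qed.

Lemma lebesgue_rV_cube r : 0 <= r ->
  lebesgue_rV R d (cube r) = ((2 * r) ^+ d)%:E.
Proof.
move=> r0; rewrite (@lebesgue_rVE R d (fun=> `[- r, r]%classic))//.
under eq_bigr do rewrite lebesgue_measure_itv/= lte_fin.
rewrite (eq_bigr (fun=> (2 * r)%:E)) => [|i _].
  by rewrite prodEFin prodr_const card_ord.
(* The interval formula tests [- r < r]; as [0 <= r], it fails only for [r = 0], where both sides
   vanish. *)
have [_|r_le] := ltP (- r) r; first by rewrite -EFinB opprK -mulr2n mulr_natl.
have -> : r = 0 by lra. by rewrite mulr0.
Qed.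

Lemma cube0 r : 0 <= r -> cube r 0.
Proof. by move=> r0 i /=; rewrite mxE in_itv/= oppr_le0 r0. Qed.

Lemma le_coord_norm (v : 'rV[R]_d) i : `|v ord0 i| <= `|v|.
Proof.
rewrite [leRHS]/Num.Def.normr/= mx_normrE.
by apply/bigmax_geP; right => /=; exists (ord0, i).
Qed.

Lemma bounded_subset_cube C : bounded_set C -> exists2 r, 0 < r & C `<=` cube r.
Proof.
move=> /ex_strict_bound_gt0[r r0 Cr]; exists r => // v Cv i /=.
rewrite in_itv/= -ler_norml (le_trans (le_coord_norm v i))//.
exact/ltW/Cr.
Qed.

Lemma bounded_cube r : 0 <= r -> bounded_set (cube r).
Proof.
move=> r0; exists r; split=> [|M rM v cv /=]; first exact: num_real.
apply: le_trans (ltW rM); rewrite [leLHS]/Num.Def.normr/= mx_normrE.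
rewrite bigmax_le//= => -[i j] _ /=; rewrite (ord1 i) ler_norml.
by have := cv j; rewrite /= in_itv.
Qed.

(** An enclosing cube bounds the volume. This makes [Vol] faithful, since [fine] would send an
    infinite measure to 0. *)
Lemma fisher_cell_fin_num C : fisher_cell C -> lebesgue_rV R d C \is a fin_num.
Proof.
move=> [mC _ /bounded_subset_cube[r r0 Cr] _].
rewrite ge0_fin_numE// (le_lt_trans _ (ltry ((2 * r) ^+ d)))//.
rewrite -lebesgue_rV_cube ?(ltW r0)//.
by apply: le_measure => //; rewrite inE//; exact: measurable_cube.
Qed.

Lemma fisher_cell_cube r : 0 < r -> fisher_cell (cube r).
Proof.
move=> r0; split; [exact: measurable_cube|exact/cube0/ltW|
  exact/bounded_cube/ltW|].
by rewrite /Vol lebesgue_rV_cube ?(ltW r0)//= exprn_gt0// mulr_gt0.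
Qed.

Lemma sqnorm_ge0 (v : 'rV[R]_d) : 0 <= sqnorm v.
Proof. by apply: sumr_ge0 => i _; exact: sqr_ge0. Qed.

Lemma measurable_sqnorm (A : set 'rV[R]_d) : measurable_fun A (@sqnorm R d).
Proof.
apply: measurable_funTS; apply: measurable_sum => i.
by apply: measurable_funX; exact: measurable_coord.
Qed.

(** A single coordinate exceeding [r] in absolute value already contributes [r ^+ 2]. *)
Lemma sqnorm_notin_cube r (v : 'rV[R]_d) : 0 <= r -> ~ cube r v ->
  r ^+ 2 <= sqnorm v.
Proof.
move=> r0 /existsNP[i /= /negP]; rewrite in_itv/= -ler_norml -ltNge => rv.
rewrite /sqnorm (bigD1 i)//= -[leLHS]addr0 lerD//; last first.
  by apply: sumr_ge0 => j _; exact: sqr_ge0.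
by rewrite -[leRHS]real_normK ?num_real// ler_pXn2r ?nnegrE//; exact: ltW.
Qed.

Lemma sqnorm_le_cube r (v : 'rV[R]_d) : cube r v -> sqnorm v <= r ^+ 2 *+ d.
Proof.
move=> cv; rewrite -[in leRHS](card_ord d) -sumr_const; apply: ler_sum => i _.
have := cv i; rewrite /= in_itv/= -ler_norml => vr.
rewrite -[leLHS]real_normK ?num_real// ler_pXn2r ?nnegrE//.
exact: le_trans vr.
Qed.

(** On an enclosing cube the integrand is bounded, and the cell has finite volume. *)
Lemma second_moment_fin_num C : fisher_cell C ->
  (\int[lebesgue_rV R d]_(u in C) (sqnorm u)%:E)%E \is a fin_num.
Proof.
move=> cC; have [mC _ /bounded_subset_cube[r r0 Cr] _] := cC.
rewrite ge0_fin_numE ?integral_ge0//; last by move=> ? _; rewrite lee_fin sqnorm_ge0.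
apply: (@le_lt_trans _ _ (\int[lebesgue_rV R d]_(u in C) cst (r ^+ 2 *+ d)%:E u)%E).
  apply: ge0_le_integral => //.
  - by move=> u _; rewrite lee_fin sqnorm_ge0.
  - by apply/measurable_EFinP; exact: measurable_sqnorm.
  - by move=> u /Cr; rewrite lee_fin; exact: sqnorm_le_cube.
rewrite integral_cst// lte_mul_pinfty ?lee_fin ?mulrn_wge0 ?sqr_ge0//.
by rewrite -ge0_fin_numE//; exact: fisher_cell_fin_num.
Qed.

(* The part of [C] outside the cube of half-side [r] has volume at least
   [Vol C - (2 r) ^+ d], and the integrand is at least [r ^+ 2] there. *)
Lemma second_moment_ge C r : fisher_cell C -> 0 <= r ->
  r ^+ 2 * (Vol C - (2 * r) ^+ d) <= second_moment C.
Proof.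
move=> cC r0; have [mC _ _ _] := cC.
have mD : measurable (C `\` cube r) by apply: measurableD => //; exact: measurable_cube.
rewrite -lee_fin fineK; last exact: second_moment_fin_num.
apply: (@le_trans _ _ (\int[lebesgue_rV R d]_(u in C `\` cube r) (sqnorm u)%:E)%E); last first.
  apply: ge0_subset_integral => //.
  - by apply/measurable_EFinP; exact: measurable_sqnorm.
  - by move=> u _; rewrite lee_fin sqnorm_ge0.
apply: (@le_trans _ _ (\int[lebesgue_rV R d]_(u in C `\` cube r) cst (r ^+ 2)%:E u)%E); last first.
  apply: ge0_le_integral => //.
  - by move=> u _; rewrite lee_fin sqr_ge0.
  - by apply/measurable_EFinP; exact: measurable_sqnorm.
  - by move=> u [_ ncu]; rewrite lee_fin sqnorm_notin_cube.
rewrite integral_cst// EFinM lee_wpmul2l ?lee_fin ?sqr_ge0//.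
have fC := fisher_cell_fin_num _ cC.
(* The volume removed is that of the intersection of [C] with the cube, at most that of the whole
   cube. *)
rewrite measureD//; [|exact: measurable_cube|by rewrite -ge0_fin_numE].
rewrite EFinB fineK// leeB// -lebesgue_rV_cube//.
by apply: le_measure; rewrite ?inE//; [apply: measurableI => //|]; exact: measurable_cube.
Qed.

End cube.

(** * Positivity of the quantisation constant and minimisation of the volume term *)

Section kappa_opt.
Context {R : realType} {d : nat}.
Hypothesis d_gt0 : (0 < d)%N.

(* [second_moment_ge] with [r] chosen so that the cube has half the volume of
   the cell. *)
Lemma kappa_ge (C : set 'rV[R]_d) : fisher_cell C ->
  2^-1 `^ (2 / d%:R) / (8 * d%:R) <= kappa C.
Proof.
move=> cC; have [_ _ _ V0] := cC.
have d0 : 0 < d%:R :> R by rewrite ltr0n.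
set V := Vol C; set r : R := (V * 2^-1) `^ d%:R^-1 / 2.
have V2 : 0 <= V * 2^-1 by rewrite mulr_ge0// ?invr_ge0// ltW.
have r0 : 0 <= r by rewrite divr_ge0// powR_ge0.
have rd : (2 * r) ^+ d = V / 2.
  rewrite /r mulrCA mulfV// mulr1 -powR_mulrn ?powR_ge0// -powRrM mulVf ?gt_eqF//.
  by rewrite powRr1.
have r2 : r ^+ 2 = V `^ (2 / d%:R) * 2^-1 `^ (2 / d%:R) / 4.
  rewrite /r exprMn -powR_mulrn ?powR_ge0// -powRrM [d%:R^-1 * _]mulrC.
  by rewrite powRM ?invr_ge0 ?(ltW V0)//; congr (_ * _); field.
have := second_moment_ge _ _ cC r0; rewrite rd r2 -/V => le_sm.
have pV : 0 < V `^ (2 / d%:R) by exact: powR_gt0.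
rewrite /kappa -/V ler_pdivlMr ?mulr_gt0 ?powR_gt0//.
rewrite powRD ?(gt_eqF V0) ?implybT// powRr1 ?(ltW V0)//.
(* Both sides agree: 8 is the 4 in [r ^+ 2] times the 2 from the half volume, and [d] cancels the
   normalisation of [kappa]. *)
apply: le_trans le_sm; rewrite le_eqVlt; apply/orP; left; apply/eqP.
by field; rewrite gt_eqF.
Qed.

Lemma kappa_opt_gt0 : 0 < kappa_opt R d.
Proof.
have d0 : 0 < d%:R :> R by rewrite ltr0n.
apply: (@lt_le_trans _ _ (2^-1 `^ (2 / d%:R) / (8 * d%:R))).
  by rewrite divr_gt0 ?mulr_gt0 ?powR_gt0 ?invr_gt0.
apply: lb_le_inf; last by move=> _ [C /kappa_ge ? <-].
(* A lower bound passes to [inf] only for a nonempty set; any cube of positive side is a witness. *)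
by exists (kappa (@cube R d 1)), (cube 1) => //; exact: fisher_cell_cube.
Qed.

(* In this parametrisation of [V > 0] minimality at [Vopt] (i.e. [y = 0]) is
   [1 + y <= expR y]. *)
Lemma volume_term_expR (y : R) :
  volume_term d (expR (d%:R / 2 * y) * kappa_opt R d `^ (- (d%:R / 2))) =
  d%:R / 2 * ln (kappa_opt R d) + d%:R / 2 * (expR y - y).
Proof.
have d0 : d%:R != 0 :> R by rewrite pnatr_eq0 -lt0n.
have k0 := kappa_opt_gt0.
rewrite /volume_term lnM ?posrE ?expR_gt0 ?powR_gt0// expRK ln_powR.
rewrite powRM ?expR_ge0 ?powR_ge0// -powRrM.
(* Raised to [2 / d], the second factor of the volume becomes the inverse of [kappa_opt R d],
   cancelling the coefficient, and the first becomes [expR y]. *)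
rewrite (_ : - (d%:R / 2) * (2 / d%:R) = -1 :> R); last by field.
rewrite powR_inv1 ?(ltW k0)// -expRM.
rewrite (_ : d%:R / 2 * y * (2 / d%:R) = y :> R); last by field.
by field; rewrite gt_eqF.
Qed.

Lemma volume_term_opt :
  volume_term d (kappa_opt R d `^ (- (d%:R / 2))) =
  d%:R / 2 * ln (kappa_opt R d) + d%:R / 2.
Proof.
by have := volume_term_expR 0; rewrite mulr0 expR0 mul1r subr0 mulr1.
Qed.

Lemma volume_term_gt (V : R) : 0 < V -> V != kappa_opt R d `^ (- (d%:R / 2)) ->
  volume_term d (kappa_opt R d `^ (- (d%:R / 2))) < volume_term d V.
Proof.
set Vo := _ `^ _ => V0 VVo; have Vo0 : 0 < Vo by exact/powR_gt0/kappa_opt_gt0.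
have d0 : 0 < d%:R / 2 :> R by rewrite divr_gt0 ?ltr0n.
(* Solving the parametrisation for [y] gives [y = (2 / d) ln (V / Vo)]. *)
have VE : V = expR (d%:R / 2 * ((d%:R / 2)^-1 * ln (V / Vo))) * Vo.
  by rewrite mulrA mulfV ?gt_eqF// mul1r lnK ?posrE ?divr_gt0// divfK ?gt_eqF.
move: VE; set y := _^-1 * _ => VE.
rewrite volume_term_opt VE volume_term_expR ltrD2l -[ltLHS]mulr1 ltr_pM2l//.
(* The exponential inequality is strict unless [y = 0], which would mean [V = Vo]. *)
rewrite ltrBrDr expR_gt1Dx//; apply: contraNneq VVo => y0.
by rewrite VE y0 mulr0 expR0 mul1r.
Qed.

End kappa_opt.

(** * Minimisers of extended-real objectives *)

Section argmin.
Context {R : realType} {U : Type}.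
Implicit Types (D : set U) (f : U -> \bar R).

(** A finite constant cancels in extended-real comparisons and leaves finiteness of the value
    unchanged. *)
Lemma argminD_fin D f (c : R) : argmin D (fun t => f t + c%:E)%E = argmin D f.
Proof.
apply/seteqP; split=> t [Dt ft le_f]; split=> //.
- by move: ft; rewrite !ltey; apply: contra => /eqP->; rewrite addye.
- by move=> s /le_f; rewrite leeD2rE.
- by rewrite lte_add_pinfty ?ltry.
- by move=> s /le_f; rewrite leeD2rE.
Qed.

Lemma argmin_widen D D' f : D `<=` D' ->
  (forall t, D' t -> ~ D t -> f t = +oo%E) -> argmin D f = argmin D' f.
Proof.
move=> DD' foo; apply/seteqP; split=> t [Dt ft le_f]; split=> //.
- exact: DD'.
- move=> s D's; have [Ds|Ds] := pselect (D s); first exact: le_f.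
  by rewrite (foo s)// leey.
(* The clause [f t < +oo] in [argmin] is what forces a minimiser over [D'] to lie in [D]. *)
- by apply: contrapT => nDt; move: ft; rewrite foo.
- by move=> s /DD'; exact: le_f.
Qed.

End argmin.

(** The prior term is [+oo]; the likelihood term is real or [+oo], and the determinant term is real,
    so nothing opposes it. *)
Lemma WF_objective_out {R : realType} {disp : measure_display}
    {T : measurableType disp} {d : nat} (p : T -> 'rV[R]_d -> R) prior J x t :
  prior t = 0 -> WF_objective p prior J x t = +oo%E.
Proof. by move=> pt; rewrite /WF_objective pt /= lexx; case: ifP. Qed.

(** * The optimised codelength and the Wallace--Freeman estimator *)

Theorem proposition3p3 (R : realType) (d : nat) (d_gt0 : (0 < d)%N)
  (disp : measure_display) (X : measurableType disp)
  (Theta K : set 'rV[R]_d) (Theta_open : open Theta)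
  (K_compact : compact K) (K_Theta : K `<=` Theta)
  (mu : forall n, {sigma_finite_measure set (n.-tuple X) -> \bar R})
  (P : forall n, 'rV[R]_d -> probability (n.-tuple X) R)
  (p : forall n, n.-tuple X -> 'rV[R]_d -> R)
  (J : nat -> 'rV[R]_d -> 'M[R]_d)
  (p_ge0 : forall n x t, (0 < n)%N -> Theta t -> 0 <= p n x t)
  (p_meas : forall n, (0 < n)%N ->
    measurable_fun (setT `*` Theta) (fun z : n.-tuple X * 'rV[R]_d => p n z.1 z.2))
  (p_density : forall n t A, (0 < n)%N -> Theta t -> measurable A ->
    P n t A = (\int[mu n]_(x in A) (p n x t)%:E)%E)
  (J_fisher : forall n t, (0 < n)%N -> Theta t ->
    fisher_information (P n t) (p n) t (J n t))
  (prior : 'rV[R]_d -> R)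
  (prior_out : forall t, ~ K t -> prior t = 0)
  (prior_gt0 : forall t, K t -> 0 < prior t)
  (prior_cont : {within K, continuous prior})
  (prior_mass1 : (\int[lebesgue_rV R d]_(t in K) (prior t)%:E)%E = 1%E)
  (k : nat -> nat)
  (cell : forall n, 'I_(k n) -> set (n.-tuple X))
  (cell_meas : forall n j, (0 < n)%N -> measurable (cell n j))
  (cell_disj : forall n, (0 < n)%N -> trivIset setT (cell n))
  (cell_cover : forall n, (0 < n)%N -> \bigcup_j cell n j = setT)
  (q : forall n, 'I_(k n) -> R)
  (q_def : forall n j, (0 < n)%N ->
    (q n j)%:E = (\int[mu n]_(x in cell n j) marginal (p n) prior K x)%E)
  (q_gt0 : forall n j, (0 < n)%N -> 0 < q n j)
  (theta : forall n, 'I_(k n) -> 'rV[R]_d)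
  (theta_K : forall n j, (0 < n)%N -> K (theta n j))
  (That : forall n, n.-tuple X -> 'rV[R]_d)
  (That_K : forall n x, (0 < n)%N -> K (That n x))
  (A1_cont : forall n, (0 < n)%N -> {within K, continuous (J n)})
  (A1_posdef : forall n t, (0 < n)%N -> K t -> posdefmx (J n t))
  (A1_lim : inf [set lambda_min (J n t) | t in K] @[n --> \oo] --> +oo)
  (A2 : forall B : set 'rV[R]_d, bounded_set B -> B !=set0 ->
    ereal_sup [set `|KL (P n (z.1 + z.2 *m invsqrtmx (J n z.1))%R) (P n z.1)
                     - (sqnorm z.2 / 2)%:E|%E | z in K `*` B]
      @[n --> \oo] --> 0%E)
  (W C : forall n, 'I_(k n) -> set 'rV[R]_d)
  (alpha : forall n, 'I_(k n) -> R)
  (A3_W_K : forall n j, (0 < n)%N -> W n j `<=` K)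
  (A3_That : forall n j x, (0 < n)%N -> cell n j x -> W n j (That n x))
  (A3_q : forall n j, (0 < n)%N ->
    q n j = prior_mass prior (W n j) * expR (alpha n j))
  (A3_alpha : \sum_(j < k n) q n j * `|alpha n j| @[n --> \oo] --> 0)
  (A3_WC : forall n j, (0 < n)%N ->
    W n j = [set theta n j + u *m invsqrtmx (J n (theta n j)) | u in C n j])
  (A3_C_meas : forall n j, (0 < n)%N -> measurable (C n j))
  (A3_C_0 : forall n j, (0 < n)%N -> C n j 0)
  (A3_C_vol : forall n j, (0 < n)%N -> 0 < Vol (C n j))
  (A3_C_diam : exists D : R, forall n j u v, (0 < n)%N ->
    C n j u -> C n j v -> enorm (u - v) <= D)
  (Delta eps : forall n, 'I_(k n) -> R)
  (A4_int : forall n j, (0 < n)%N ->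
    (mu n).-integrable (cell n j)
      (fun x => (- lne (p n x (theta n j))%:E + lne (p n x (That n x))%:E)
                * marginal (p n) prior K x)%E)
  (A4_Delta : forall n j, (0 < n)%N ->
    (Delta n j)%:E = ((q n j)^-1%:E * \int[mu n]_(x in cell n j)
      ((- lne (p n x (theta n j))%:E + lne (p n x (That n x))%:E)
       * marginal (p n) prior K x))%E)
  (A4 : forall n j, (0 < n)%N ->
    (Delta n j)%:E = ((prior_mass prior (W n j))^-1%:E
      * (\int[lebesgue_rV R d]_(t in W n j)
           (KL (P n t) (P n (theta n j)) * (prior t)%:E)) + (eps n j)%:E)%E)
  (A4_eps : \sum_(j < k n) q n j * `|eps n j| @[n --> \oo] --> 0)
  (A5 : \sum_(j < k n) q n j * Phi (C n j) @[n --> \oo]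
    --> d%:R / 2 * ln (kappa_opt R d) + d%:R / 2)
  (A6 : let phi n t := - ln (prior t) + ln (\det (J n t)) / 2 in
    (\sum_(j < k n) q n j * phi n (theta n j))
      - \int[lebesgue_rV R d]_(t in K) (phi n t * prior t)
      @[n --> \oo] --> 0)
  (Lambda : forall n, n.-tuple X -> 'rV[R]_d -> R -> \bar R)
  (Lambda_expansion : local_expansion P K Lambda
     (fun n => WF_objective (p n) prior (J n))) :
  let g := volume_term d in
  let Vopt := kappa_opt R d `^ (- (d%:R / 2)) in
  let objective n := WF_objective (p n) prior (J n) in
  let codelength n := WF_codelength (p n) prior (J n) in
  [/\ [/\ 0 < Vopt,
          forall V : R, 0 < V -> V != Vopt -> g Vopt < g V
        & g Vopt = d%:R / 2 * ln (kappa_opt R d) + d%:R / 2],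
      exists rem : forall n, n.-tuple X -> 'rV[R]_d -> R,
        (forall n x t, (0 < n)%N -> K t ->
           Lambda n x t Vopt
           = (objective n x t
              + (d%:R / 2 * ln (kappa_opt R d) + d%:R / 2)%:E
              + (rem n x t)%:E)%E) /\
        small_oP P K rem,
      forall n x, (0 < n)%N -> argmin K (codelength n x) = argmin K (objective n x)
    & forall n x t (N : set 'rV[R]_d), (0 < n)%N ->
        argmin K (codelength n x) t -> K° t ->
        compact N -> nbhs t N -> N `<=` Theta ->
        local_expansion P N Lambda (fun n => WF_objective (p n) prior (J n)) ->
        argmin K (codelength n x) = argmin Theta (objective n x)].

Proof.
move=> g Vopt objective codelength.
have Vopt0 : 0 < Vopt by exact/powR_gt0/kappa_opt_gt0.
split=> [|| n x n0 | n x t N n0 _ _ _ _ _ _].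
- split=> //; [exact: volume_term_gt|exact: volume_term_opt].
- have [rem [LambdaE rem_small]] := Lambda_expansion.
  exists (fun n x t => rem n x t Vopt); split=> [n x t n0 Kt|e e0].
    by rewrite LambdaE// volume_term_opt.
  (* Over the singleton of [Vopt] the supremum is the value itself, so the locally uniform bound
     specialises to the fixed volume. *)
  have eventE n t : [set x | e < `|rem n x t Vopt|] =
      [set x | (e%:E < ereal_sup [set `|rem n x t V|%:E | V in [set Vopt]])%E].
    by apply/funext => x; rewrite /mkset image_set1 ereal_sup1 lte_fin.
  under eq_fun do under eq_imagel do rewrite eventE.
  apply: rem_small => //; first exact: compact_set1.
  by move=> _ ->.
- exact: argminD_fin.
(* Dropping the constant leaves the objective, which is [+oo] on [Theta] outside [K] because the
   prior vanishes there. *)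
- rewrite [LHS]argminD_fin; apply: argmin_widen => // s _ Ks.
  by rewrite /objective WF_objective_out// prior_out.
Qed.
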